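(* Let $\Phi$ be a real, additive gain graph on $n$ vertices and let $d\leq n$. For generic $\mathbf{Q}\in(\mathbb{E}^d)^n$ (i.e. for all $\mathbf{Q}$ in an open dense subset), the arrangement $\mathcal{H}=\mathcal{H}(\Phi;\mathbf{Q})$ has characteristic polynomial $p_{\mathcal{H}}(\lambda)$ equal to the polynomial part of $\chi^b_\Phi(\lambda)/\lambda^{n-d}$, and Whitney-number polynomial $w_{\mathcal{H}}(x,\lambda)$ equal to the polynomial part (in $\lambda$) of $w^b_\Phi(x,\lambda)/\lambda^{n-d}$.
   Context: A real, additive gain graph $\Phi$ on $V=\{1,\dots,n\}$: finite graph with edge set $E$ (multiple edges allowed, every edge with two distinct endpoints) and gains $\phi(e;i,j)\in\mathbb{R}$ with $\phi(e;j,i)=-\phi(e;i,j)$. $S\subseteq E$ is balanced if every circle in $S$ has gain sum $0$; $c(S)$ counts components of $(V,S)$, isolated vertices included. With $\psi_{ij}(P)=d(P,Q_i)^2-d(P,Q_j)^2$, $\mathcal{H}(\Phi;\mathbf{Q})$ consists of hyperplanes $h(e)=\{P:\psi_{ij}(P)=\phi(e;i,j)\}$, one per edge $e$ with endpoints $i,j$. $\mathcal{L}(\mathcal{H})$ is the poset of nonempty intersections of subsets of $\mathcal{H}$ (including $\mathbb{E}^d$) under reverse inclusion, ranked by codimension. A balanced flat is a balanced $S\subseteq E$ such that every $e\notin S$ with both endpoints in one component of $(V,S)$ makes $S\cup\{e\}$ unbalanced; rank $n-c(S)$; $\mathrm{Lat}^b\Phi$ is the poset of balanced flats under inclusion. For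 a ranked poset $P$ with least element $\hat0$ and Möbius function $\mu$: $w_{ij}(P)=\sum\{\mu(x,y):\mathrm{rk}\,x=i,\mathrm{rk}\,y=j\}$, $w_j=w_{0j}$, and $w_j=w_{ij}=0$ when $j$ exceeds the maximum rank. For an arrangement $\mathcal{H}$ in $\mathbb{E}^d$: $p_{\mathcal{H}}(\lambda)=\sum_{j=0}^dw_j(\mathcal{L}(\mathcal{H}))\lambda^{d-j}$ and $w_{\mathcal{H}}(x,\lambda)=\sum_{0\leq i\leq j\leq d}w_{ij}(\mathcal{L}(\mathcal{H}))x^i\lambda^{d-j}$. For $\Phi$: $\chi^b_\Phi(\lambda)=\sum_{j=0}^nw_j(\mathrm{Lat}^b\Phi)\lambda^{n-j}$ and $w^b_\Phi(x,\lambda)=\sum_{0\leq i\leq j\leq n}w_{ij}(\mathrm{Lat}^b\Phi)x^i\lambda^{n-j}$. The polynomial part of a Laurent polynomial in $\lambda$ is the sum of its terms with nonnegative powers of $\lambda$. *)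

(* Defs.v *)
From HB Require Import structures.
From mathcomp Require Import all_boot all_order all_algebra finmap.
From mathcomp Require Import all_classical all_reals all_analysis.
Set Implicit Arguments. Unset Strict Implicit. Unset Printing Implicit Defensive.
Import Order.TTheory GRing.Theory Num.Theory.
Import numFieldNormedType.Exports.
Local Open Scope classical_set_scope.
Local Open Scope ring_scope.

Section Whitney.
Variables (R : realType) (T : finType) (le : rel T) (rk : T -> nat).

Definition zeta_mx : 'M[R]_#|T| :=
  \matrix_(i, j) (le (enum_val i) (enum_val j))%:R.

Definition mobius (x y : T) : R :=
  invmx zeta_mx (enum_rank x) (enum_rank y).

Definition whitney (i j : nat) : R :=
  \sum_(x : T | rk x == i) \sum_(y : T | rk y == j) mobius x y.

Definition char_poly (N : nat) : {poly R} :=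
  \sum_(j < N.+1) whitney 0 j *: 'X^(N - j).

(* sum_{0<=i<=j<=N} w_ij x^i lambda^(N-j), as a polynomial in lambda
   (outer variable) with coefficients polynomials in x (inner variable) *)
Definition whitney_poly (N : nat) : {poly {poly R}} :=
  \sum_(j < N.+1) (\sum_(i < j.+1) whitney i j *: ('X^i : {poly R})) *: 'X^(N - j).
End Whitney.

Definition poly_part_div (A : nzRingType) (m : nat) (p : {poly A}) : {poly A} :=
  drop_poly m p.

(* Gain graphs.  Vertices 'I_n; edge type E (finite, multiple edges    *)
(* allowed); each edge e has an ordered pair of distinct endpoints      *)
(* ends e = (i, j) and gain phi e = phi(e; i, j); phi(e; j, i) = -phi e. *)
Section GainGraph.
Variables (R : realType) (n : nat) (E : finType)
  (ends : E -> 'I_n * 'I_n) (phi : E -> R).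

Definition joins (e : E) (u v : 'I_n) : bool :=
  (ends e == (u, v)) || (ends e == (v, u)).

Definition gain (e : E) (u v : 'I_n) : R :=
  if ends e == (u, v) then phi e else - phi e.

Definition is_circle_in (S : {set E}) (k : nat)
    (vs : 'I_k.+2 -> 'I_n) (es : 'I_k.+2 -> E) : Prop :=
  [/\ injective vs, injective es, (forall l, es l \in S) &
      forall l, joins (es l) (vs l) (vs (ordS l))].

Definition circle_gain (k : nat) (vs : 'I_k.+2 -> 'I_n) (es : 'I_k.+2 -> E) : R :=
  \sum_(l < k.+2) gain (es l) (vs l) (vs (ordS l)).

Definition balanced (S : {set E}) : Prop :=
  forall k vs es, is_circle_in S (k := k) vs es -> circle_gain vs es = 0.

Definition adj (S : {set E}) : rel 'I_n :=
  fun u v => [exists e in S, joins e u v].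

Definition ncomp (S : {set E}) : nat := n_comp (adj S) predT.

Definition balanced_flat (S : {set E}) : Prop :=
  balanced S /\
  forall e, e \notin S -> connect (adj S) (ends e).1 (ends e).2 ->
    ~ balanced (e |: S).

Definition latb : Type := {S : {set E} | `[< balanced_flat S >]}.
Definition latb_le : rel latb := fun S T => val S \subset val T.
Definition latb_rk (S : latb) : nat := (n - ncomp (val S))%N.

Definition chib : {poly R} := char_poly R latb_le latb_rk n.
Definition wb : {poly {poly R}} := whitney_poly R latb_le latb_rk n.

Variable d : nat.

Definition sqdist (P P' : 'rV[R]_d) : R := \sum_(k < d) (P 0 k - P' 0 k) ^+ 2.

Definition psi (Q : 'M[R]_(n, d)) (i j : 'I_n) (P : 'rV[R]_d) : R :=
  sqdist P (row i Q) - sqdist P (row j Q).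

Definition hyp (Q : 'M[R]_(n, d)) (e : E) : set 'rV[R]_d :=
  [set P | psi Q (ends e).1 (ends e).2 P = phi e].

Definition inter (Q : 'M[R]_(n, d)) (S : {set E}) : set 'rV[R]_d :=
  [set P | forall e, e \in S -> hyp Q e P].

Definition LH (Q : 'M[R]_(n, d)) : {fset (set 'rV[R]_d)} :=
  ([fset inter Q S | S : {set E} & `[< inter Q S !=set0 >]])%fset.

Definition affdim (X : set 'rV[R]_d) : nat :=
  \max_(k < d.+1 | `[< exists p0 (M : 'M[R]_(k, d)),
                        [/\ X p0, row_free M & forall i, X (p0 + row i M)] >]) k.

Definition LH_le (Q : 'M[R]_(n, d)) : rel (LH Q) :=
  fun x y => `[< (val y) `<=` (val x) >].
Definition LH_rk (Q : 'M[R]_(n, d)) (x : LH Q) : nat := (d - affdim (val x))%N.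

Definition pH (Q : 'M[R]_(n, d)) : {poly R} := char_poly R (@LH_le Q) (@LH_rk Q) d.
Definition wH (Q : 'M[R]_(n, d)) : {poly {poly R}} :=
  whitney_poly R (@LH_le Q) (@LH_rk Q) d.
End GainGraph.

(* Main.v *)
(* Sending an intersection X of hyperplanes to the set of all edges e with
   X included in h(e) embeds L(H) into Lat^b: on a nonempty intersection the
   gains are differences of the potential u |-> d(P, Q_u)^2, which forces balance
   and flatness.  Conversely a balanced edge set S carries a potential f, and
   cutting out its intersection amounts to n - c(S) equations
   psi_uv(P) = f u - f v, one for each vertex u other than the chosen root v of its
   component.  For generic Q these are independent when n - c(S) <= d and
   inconsistent otherwise, so ranks agree and the image is the lower ideal of
   flats of rank at most d.  The Mobius function of a lower ideal is the
   restriction of the ambient one, and truncating to ranks at most d is exactly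
   taking the polynomial part. *)
Require Import Defs.
From HB Require Import structures.
From mathcomp Require Import all_boot all_order all_algebra finmap.
From mathcomp Require Import all_classical all_reals all_analysis.
From mathcomp Require Import zify ring lra.
Import Order.TTheory GRing.Theory Num.Theory.
Import numFieldNormedType.Exports.
Local Open Scope classical_set_scope.
Local Open Scope ring_scope.
Set Implicit Arguments.
Unset Strict Implicit.
Unset Printing Implicit Defensive.

(** * Möbius functions and Whitney numbers of order ideals *)

(** Induction on the size of the down-set of [y] replaces the triangular form along a linear
    extension: column [y] expresses [v] at [y] through its values strictly below [y]. *)
Lemma zeta_mx_unit (R : realType) (T : finType) (le : rel T) :
  reflexive le -> antisymmetric le -> transitive le ->
  zeta_mx R le \in unitmx.
Proof.
move=> lexx le_anti le_trans; rewrite -row_free_unit.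
apply/inj_row_free => v vZ.
suff v0 m y : (#|[pred x | le x y]| <= m)%N -> v 0 (enum_rank y) = 0.
  apply/rowP => i; rewrite mxE -[i]enum_valK.
  exact: (v0 _ _ (leqnn _)).
elim: m y => [|m IH] y.
  rewrite leqn0 => /eqP/card0_eq/(_ y); by rewrite !inE lexx.
move=> cy.
have /rowP/(_ (enum_rank y)) := vZ; rewrite !mxE.
rewrite (bigD1 (enum_rank y)) //= mxE !enum_rankK lexx mulr1 big1 ?addr0 //.
move=> i iy; rewrite mxE enum_rankK.
case: (boolP (le (enum_val i) y)) => [le_iy|_]; last by rewrite mulr0.
suff -> : v 0 i = 0 by rewrite mul0r.
rewrite -[i]enum_valK; apply: IH; rewrite -ltnS; apply: leq_trans cy.
apply/proper_card/properP; split.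
  by apply/fintype.subsetP => x; rewrite !inE => /le_trans; apply.
exists y; rewrite ?inE //; apply/negP => le_yi.
have : enum_val i = y by apply: le_anti; rewrite le_iy.
by move/(congr1 enum_rank); rewrite enum_valK => /eqP; rewrite (negbTE iy).
Qed.

(** After reversal the coefficient of degree k is [w (n - k)]; dropping n - d degrees turns it into
    [w (d - k)], so exactly the ranks up to d survive. *)
Lemma drop_poly_sum_rev (A : nzRingType) (n d : nat) (w : nat -> A) :
  (d <= n)%N ->
  drop_poly (n - d) (\sum_(j < n.+1) w j *: 'X^(n - j)) =
  \sum_(j < d.+1) w j *: 'X^(d - j).
Proof.
have revE N : \sum_(j < N.+1) w j *: 'X^(N - j) = \poly_(j < N.+1) w (N - j)%N.
  rewrite poly_def (reindex_inj rev_ord_inj) /=; apply: eq_bigr => j _.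
  by rewrite subSS subKn // -ltnS.
move=> dn; rewrite !revE; apply/polyP => k; rewrite coef_drop_poly !coef_poly.
have -> : (k + (n - d) < n.+1)%N = (k < d.+1)%N by rewrite addnC -ltn_subRL subSn ?leq_subr // subKn.
by rewrite addnC subnDA subKn.
Qed.

Section OrderIdeal.
Variables (R : realType) (T' T : finType) (le' : rel T') (le : rel T).
Variables (rk' : T' -> nat) (rk : T -> nat) (d : nat) (f : T' -> T).
Hypotheses (lexx : reflexive le) (le_anti : antisymmetric le)
  (le_trans : transitive le).
Hypotheses (f_inj : injective f) (f_le : forall x y, le (f x) (f y) = le' x y).

(** The block of the big Möbius matrix on the image of [f] is a left inverse of the small zeta
    matrix: in each entry of the product, an index z outside the image would have to lie below some
    [f y], which [f_down] excludes. *)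
Lemma mobius_ideal (f_down : forall x z, le z (f x) -> z \in codom f) x y :
  mobius R le' x y = mobius R le (f x) (f y).
Proof.
have Zu := @zeta_mx_unit R T le lexx le_anti le_trans.
pose M : 'M[R]_#|T'| :=
  \matrix_(i, j) mobius R le (f (enum_val i)) (f (enum_val j)).
suff MZ : M *m zeta_mx R le' = 1%:M.
  have Zu' : zeta_mx R le' \in unitmx by case: (mulmx1_unit MZ).
  have <- : M (enum_rank x) (enum_rank y) = mobius R le' x y.
    by rewrite -[M](mulmxK Zu') MZ mul1mx.
  by rewrite mxE !enum_rankK.
apply/matrixP => i j; rewrite !mxE.
have /matrixP/(_ (enum_rank (f (enum_val i))) (enum_rank (f (enum_val j)))) := mulVmx Zu.
rewrite !mxE (can_eq enum_rankK) (inj_eq f_inj) (inj_eq enum_val_inj) => <-.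
rewrite (reindex_onto enum_rank enum_val) /=; last by move=> k _; rewrite enum_valK.
rewrite (reindex_onto (@enum_rank T) enum_val) /=; last by move=> k _; rewrite enum_valK.
under eq_bigl => k do rewrite enum_rankK eqxx.
under [RHS]eq_bigl => k do rewrite enum_rankK eqxx.
rewrite [RHS](bigID (mem [set f x | x in T']%SET)) /= [X in _ + X]big1 ?addr0; last first.
  move=> z zf; rewrite mxE !enum_rankK; case: (boolP (le z (f (enum_val j)))).
    by move=> /f_down/codomP[u zu]; move/negP: zf; case; rewrite zu; apply/imsetP; exists u.
  by rewrite mulr0.
rewrite big_imset /=; last by move=> ? ? _ _; apply: f_inj.
by apply: eq_big => // k _; rewrite !mxE !enum_rankK f_le.
Qed.

Hypotheses (f_rk : forall x, rk (f x) = rk' x)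
  (rk_le : forall x y, le x y -> (rk x <= rk y)%N)
  (f_codom : forall y, (y \in codom f) = (rk y <= d)%N).

(** Monotonicity of [rk] makes the image of [f] a lower ideal, and every element of rank at most d
    lies in it, so both double sums run over the same elements. *)
Lemma whitney_ideal i j : (i <= d)%N -> (j <= d)%N ->
  whitney R le' rk' i j = whitney R le rk i j.
Proof.
have f_down x z : le z (f x) -> z \in codom f.
  by move=> /rk_le zx; rewrite f_codom (leq_trans zx) // -f_codom codom_f.
have rk_imset k : (k <= d)%N ->
    (f @: [set x | rk' x == k] = [set y | rk y == k])%SET.
  move=> kd; apply/setP => y; rewrite inE; apply/imsetP/eqP => [[x]|yk].
    by rewrite inE /= => /eqP <- ->.
  have /codomP[x yx] : y \in codom f by rewrite f_codom yk.
  by exists x => //; rewrite inE -f_rk -yx yk /=.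
have sum_rk k (G : T -> R) : (k <= d)%N ->
    \sum_(x | rk' x == k) G (f x) = \sum_(y | rk y == k) G y.
  move=> /rk_imset/setP kE.
  rewrite -[RHS](eq_bigl _ _ (fun y => etrans (kE y) (finset.in_set _ y))).
  rewrite big_imset /=; last by move=> ? ? _ _; apply: f_inj.
  by apply: eq_bigl => x; rewrite inE.
move=> id jd; rewrite /whitney -sum_rk //; apply: eq_bigr => x _.
by rewrite -sum_rk //; apply: eq_bigr => y _; rewrite mobius_ideal.
Qed.

Lemma char_poly_ideal n : (d <= n)%N ->
  Defs.char_poly R le' rk' d = poly_part_div (n - d) (Defs.char_poly R le rk n).
Proof.
move=> dn; rewrite /poly_part_div /Defs.char_poly drop_poly_sum_rev //.
by apply: eq_bigr => j _; rewrite whitney_ideal // -ltnS.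
Qed.

Lemma whitney_poly_ideal n : (d <= n)%N ->
  whitney_poly R le' rk' d = poly_part_div (n - d) (whitney_poly R le rk n).
Proof.
move=> dn; rewrite /poly_part_div /whitney_poly.
rewrite (drop_poly_sum_rev (fun j => \sum_(i < j.+1) whitney R le rk i j *: 'X^i)) //.
apply: eq_bigr => j _; congr (_ *: _); apply: eq_bigr => i _.
by rewrite whitney_ideal // -ltnS ?(leq_trans (ltn_ord i)).
Qed.

End OrderIdeal.

(** * Potentials and balanced flats *)

Section GainGraphs.
Variables (R : realType) (n : nat) (E : finType).
Variables (ends : E -> 'I_n * 'I_n) (phi : E -> R).

Implicit Types (S T : {set E}) (f : 'I_n -> R).

Notation src e := (ends e).1.
Notation tgt e := (ends e).2.

Definition potential (S : {set E}) (f : 'I_n -> R) : Prop :=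
  forall e, e \in S -> phi e = f (src e) - f (tgt e).

Lemma gain_potential S f e u v :
  potential S f -> e \in S -> joins ends e u v -> gain ends phi e u v = f u - f v.
Proof.
move=> fS eS; rewrite /joins /gain (fS e eS); case: eqP => [-> //|_ /=] /eqP-> /=.
by rewrite opprB.
Qed.

(** The differences of [f] telescope around a circle, as [ordS] permutes its positions. *)
Lemma potential_balanced S f : potential S f -> balanced ends phi S.
Proof.
move=> fS k vs es [_ _ esS joinsE]; rewrite /circle_gain.
under eq_bigr => l _ do rewrite (gain_potential fS (esS l) (joinsE l)).
by rewrite sumrB [X in X - _](reindex_inj (@ordS_inj k.+2)) subrr.
Qed.

Lemma balancedS S T : S \subset T -> balanced ends phi T -> balanced ends phi S.
Proof.
move=> ST balT k vs es [vs_inj es_inj esS joinsE]; apply: balT; split=> // l.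
exact: fintype.subsetP ST _ (esS l).
Qed.

Lemma adj_sym S : symmetric (adj ends S).
Proof. by move=> u v; apply: eq_existsb => e; rewrite /joins orbC. Qed.

Lemma connect_adj_sym S : connect_sym (adj ends S).
Proof. exact: sym_connect_sym (adj_sym S). Qed.

Lemma adj_ends S e : e \in S -> adj ends S (src e) (tgt e).
Proof. by move=> eS; apply/exists_inP; exists e; rewrite // /joins -surjective_pairing eqxx. Qed.

Lemma connect_adjS S T u v :
  S \subset T -> connect (adj ends S) u v -> connect (adj ends T) u v.
Proof.
move=> /fintype.subsetP ST; apply: connect_sub => {u v} u v /exists_inP[e eS uv].
by apply/connect1/exists_inP; exists e => //; apply: ST.
Qed.

(** The target type is arbitrary so that [h] may be real-valued, or the identity to show that
    components without edges are singletons. *)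
Lemma connect_adj_const (A : Type) S (h : 'I_n -> A) u v :
  (forall e, e \in S -> h (src e) = h (tgt e)) -> connect (adj ends S) u v -> h u = h v.
Proof.
move=> hS /connectP[p]; elim: p u => [u _ -> //|w p IH u] /= /andP[/exists_inP[e eS]].
by move=> /orP[]/eqP ew pw vE; rewrite -(IH w) //; have := hS e eS; rewrite ew.
Qed.

Hypothesis ends_neq : forall e, src e != tgt e.

(** A simple path in [S] between the ends of [e], closed up by [e], is a circle; its gain is zero
    and the gains along the path telescope. *)
Lemma potential_closing_edge S e f :
  e \notin S -> potential S f -> balanced ends phi (e |: S) ->
  connect (adj ends S) (src e) (tgt e) -> phi e = f (src e) - f (tgt e).
Proof.
move=> eS fS bal /connectP[p0 + +]; case/shortenP => p path_p uniq_p _ tgtE.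
(* The ends of [e] differ, so the path has an edge and the circle has length at least 2, as the
   index type ['I_k.+2] demands. *)
have [k sz_p] : exists k, size p = k.+1.
  case: p tgtE {path_p uniq_p} => [tgtE|x p _]; last by exists (size p).
  by have := ends_neq e; rewrite tgtE eqxx.
pose s := src e :: p; pose v (l : nat) := nth (src e) s l.
have sz_s : size s = k.+2 by rewrite /= sz_p.
have v_inj i j : (i < k.+2)%N -> (j < k.+2)%N -> v i = v j -> i = j.
  by move=> ik jk /eqP; rewrite nth_uniq ?sz_s // => /eqP.
have v0 : v 0%N = src e by [].
have vlast : v k.+1 = tgt e by rewrite tgtE (last_nth (src e)) sz_p.
(* The default [e] is never taken between consecutive path vertices, by [edP]. *)
pose ed x y := odflt e [pick e' in S | joins ends e' x y].
have edP l : (l < k.+1)%N ->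
    ed (v l) (v l.+1) \in S /\ joins ends (ed (v l) (v l.+1)) (v l) (v l.+1).
  move=> lk; have /exists_inP[e' e'S ve'] : adj ends S (v l) (v l.+1).
    by move/(pathP (src e)): path_p; apply; rewrite sz_p.
  rewrite /ed; case: pickP => [e'' /andP[]//|/(_ e')]; by rewrite e'S ve'.
pose vs (l : 'I_k.+2) := v l.
pose es (l : 'I_k.+2) := if (l < k.+1)%N then ed (v l) (v l.+1) else e.
have ltk (l : 'I_k.+2) : l != ord_max -> (l < k.+1)%N.
  by move=> lmax; rewrite ltn_neqAle -ltnS ltn_ord andbT.
have ordSk (l : 'I_k.+2) : (l < k.+1)%N -> vs (ordS l) = v l.+1.
  by move=> lk; rewrite /vs /= modn_small.
have ordSmax : vs (ordS ord_max) = src e by rewrite /vs /= modnn.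
have vsmax : vs ord_max = tgt e by rewrite /vs /= vlast.
have esmax : es ord_max = e by rewrite /es /= ltnn.
have vs_inj : injective vs by move=> i j /v_inj ij; apply/val_inj/ij.
have es_inj : injective es.
  (* An edge determines its unordered pair of ends, and a simple path repeats no such pair; [e]
     itself is not in [S]. *)
  have esl (l l' : 'I_k.+2) : (l < k.+1)%N -> es l = es l' -> l = l'.
    move=> lk; have [edS edl] := edP _ lk; rewrite /es lk; case: ltnP => l'k edE.
      have [_] := edP _ l'k; move: edl; rewrite /joins -edE.
      move=> /orP[]/eqP -> /orP[]/eqP[] /v_inj h1 /v_inj h2; apply/val_inj => /=; lia.
    by rewrite edE (negbTE eS) in edS.
  move=> l l' ll'; have [lmax|/ltk lk] := eqVneq l ord_max; last exact: esl.
  have [->//|/ltk l'k] := eqVneq l' ord_max.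
  by apply/esym/esl.
have circ : is_circle_in ends (e |: S) vs es.
  split=> // l; have [->|/ltk lk] := eqVneq l ord_max.
  - by rewrite esmax setU11.
  - by rewrite /es lk inE; have [-> _] := edP _ lk; rewrite orbT.
  - by rewrite esmax ordSmax vsmax /joins -surjective_pairing eqxx orbT.
  - by rewrite ordSk // /es lk; have [] := edP _ lk.
have /eqP := bal _ _ _ circ; rewrite -[X in X == _]subr0.
(* Subtracting zero, written as the sum of [f] around the circle minus its cyclic shift, cancels
   every term but that of [e], which is traversed from target to source. *)
rewrite -[X in _ - X](subrr (\sum_(l < k.+2) f (vs l))).
rewrite [X in _ - (_ - X)](reindex_inj (@ordS_inj k.+2)) /= -!sumrB.
rewrite (bigD1 ord_max) //= big1 ?addr0 => [|l /ltk lk]; last first.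
  have [lS ljoin] := edP _ lk; rewrite /es lk ordSk //.
  by rewrite (gain_potential fS lS ljoin) subrr.
rewrite esmax vsmax ordSmax /gain; have [/(congr1 fst) /= srcE|_] := eqVneq (ends e) (tgt e, src e).
  by have := ends_neq e; rewrite srcE eqxx.
by rewrite subr_eq0 => /eqP/(congr1 -%R); rewrite opprK opprB.
Qed.

(** Induction on the number of edges. Removing [e] leaves a potential: it already fits [e] if the
    ends remain connected, and otherwise can be shifted on one component. *)
Lemma balanced_potential S : balanced ends phi S -> exists f, potential S f.
Proof.
have [m] := ubnP #|S|; elim: m S => // m IH S; rewrite ltnS => Sm balS.
have [->|[e eS]] := set_0Vmem S.
  by exists (fun=> 0) => e; rewrite inE.
have Se : (#|S :\ e| < m)%N by rewrite (cardsD1 e) eS in Sm.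
have [f fS] := IH _ Se (balancedS (subsetDl S [set e]) balS).
have [conn|disc] := boolP (connect (adj ends (S :\ e)) (src e) (tgt e)).
  exists f => e' e'S; have [->|e'e] := eqVneq e' e; last by apply: fS; rewrite !inE e'e e'S.
  apply: (potential_closing_edge _ fS _ conn); last by rewrite finset.setD1K.
  by rewrite finset.setD11.
(* The defect of [f] at [e], added throughout the component of the source; differences along the
   other edges do not change. *)
pose c := phi e - (f (src e) - f (tgt e)).
exists (fun u => f u + (connect (adj ends (S :\ e)) (src e) u)%:R * c) => e' e'S.
have [->|e'e] := eqVneq e' e.
  by rewrite connect0 (negbTE disc) mul1r mul0r addr0 /c; ring.
have e'Se : e' \in S :\ e by rewrite !inE e'e e'S.
rewrite (fS _ e'Se) (same_connect_r (connect_adj_sym _) (connect1 (adj_ends e'Se))).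
by ring.
Qed.

Notation rep S := (fingraph.root (adj ends S)).

Lemma ncompE S : ncomp ends S = #|[pred u | rep S u == u]|.
Proof. by apply: eq_card => u; rewrite !inE andbT. Qed.

Lemma rep_connect S u : connect (adj ends S) u (rep S u).
Proof. exact: connect_root. Qed.

Lemma rep_eq S u v : (rep S u == rep S v) = connect (adj ends S) u v.
Proof. exact/root_connect/connect_adj_sym. Qed.

Lemma rep_image_sub S T : S \subset T ->
  [pred u | rep T u == u] \subset fintype.image (rep T) [pred u | rep S u == u].
Proof.
move=> ST; apply/fintype.subsetP => u; rewrite inE => /eqP uT.
apply/fintype.imageP; exists (rep S u); first by rewrite inE rep_eq connect_adj_sym rep_connect.
by rewrite -{1}uT; apply/eqP; rewrite rep_eq (connect_adjS ST) ?rep_connect.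
Qed.

Lemma ncompS S T : S \subset T -> (ncomp ends T <= ncomp ends S)%N.
Proof.
move=> ST; rewrite !ncompE.
exact: leq_trans (subset_leq_card (rep_image_sub ST)) (leq_image_card _ _).
Qed.

(** Sending roots of [S] to roots of [T] reaches every component of [T]; with equal counts it is
    injective, so no two components of [S] merge. *)
Lemma ncomp_eq_connect S T u v : S \subset T -> ncomp ends S = ncomp ends T ->
  connect (adj ends T) u v -> connect (adj ends S) u v.
Proof.
move=> ST; rewrite !ncompE => eqST.
have /fintype.image_injP inj : #|fintype.image (rep T) [pred u | rep S u == u]| == #|[pred u | rep S u == u]|.
  by rewrite eqn_leq leq_image_card eqST subset_leq_card ?rep_image_sub.
rewrite -!rep_eq => /eqP uvT; apply/eqP/inj; rewrite ?inE ?rep_eq.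
- by rewrite connect_adj_sym rep_connect.
- by rewrite connect_adj_sym rep_connect.
have repT w : rep T (rep S w) = rep T w.
  by apply/eqP; rewrite rep_eq connect_adj_sym (connect_adjS ST) ?rep_connect.
by rewrite !repT.
Qed.

(** The non-root vertices will index the equations that cut out an intersection. *)
Lemma corankE S : (n - ncomp ends S)%N = #|[pred u | rep S u != u]|.
Proof.
rewrite ncompE; have := cardC [pred u | rep S u == u]; rewrite card_ord => nE.
by rewrite -[X in (X - _)%N]nE addKn.
Qed.

Lemma latb_le_refl : reflexive (@latb_le R n E ends phi).
Proof. by move=> S; apply: fintype.subxx. Qed.

Lemma latb_le_anti : antisymmetric (@latb_le R n E ends phi).
Proof. by move=> S T; rewrite /latb_le -finset.eqEsubset => /eqP/val_inj. Qed.

Lemma latb_le_trans : transitive (@latb_le R n E ends phi).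
Proof. by move=> T S U; apply: fintype.subset_trans. Qed.

Lemma latb_rk_le (S T : latb ends phi) : latb_le S T -> (latb_rk S <= latb_rk T)%N.
Proof. by move=> ST; rewrite /latb_rk leq_sub2l ?ncompS. Qed.

Lemma latbP (S : latb ends phi) : balanced_flat ends phi (val S).
Proof. exact/asboolP/(valP S). Qed.

(** Equal rank means equal components, so an edge of [T] outside [S] would have its ends connected
    in [S]; flatness of [S] then contradicts balance of [T]. *)
Lemma latb_eq (S T : latb ends phi) : latb_le S T -> latb_rk S = latb_rk T -> S = T.
Proof.
move=> ST rkST; apply: latb_le_anti; rewrite ST; apply/fintype.subsetP => e eT.
have [balT _] := latbP T; have [_ flatS] := latbP S.
apply: contraT => eS; case: (flatS e eS); last first.
  by apply: balancedS balT; rewrite finset.subUset finset.sub1set eT.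
apply: (ncomp_eq_connect ST); last exact/connect1/adj_ends.
have ncomp_le U : (ncomp ends U <= n)%N by rewrite ncompE (leq_trans (max_card _)) ?card_ord.
by rewrite -[LHS](subKn (ncomp_le _)) -[RHS](subKn (ncomp_le _)); congr (_ - _)%N.
Qed.

End GainGraphs.
(** * Generic points *)

Section PolynomialFunctions.
Variables (R : realType) (m n : nat).
Implicit Types (F G : 'M[R]_(m, n) -> R).

(* Only these two consequences of being polynomial in the entries matter:
   non-vanishing is then an open condition, and a dense one by restriction
   to a line through a point where [F] does not vanish. *)
Definition polyfun F : Prop :=
  continuous F /\ forall A B, exists p : {poly R}, forall t, F (A + t *: B) = p.[t].

Lemma polyfun_coord i j : polyfun (fun Q => Q i j).
Proof.
split=> [|A B]; first exact: coord_continuous.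
by exists ((A i j)%:P + (B i j) *: 'X) => t; rewrite !hornerE !mxE mulrC.
Qed.

Lemma polyfun_cst c : polyfun (fun=> c).
Proof. by split=> [|A B]; [exact: cst_continuous | exists c%:P => t; rewrite hornerC]. Qed.

Lemma polyfunD F G : polyfun F -> polyfun G -> polyfun (fun Q => F Q + G Q).
Proof.
move=> [cF pF] [cG pG]; split=> [Q|A B]; first by apply: continuousD; [apply: cF|apply: cG].
by have [[p pE] [q qE]] := (pF A B, pG A B); exists (p + q) => t; rewrite hornerD pE qE.
Qed.

Lemma polyfunM F G : polyfun F -> polyfun G -> polyfun (fun Q => F Q * G Q).
Proof.
move=> [cF pF] [cG pG]; split=> [Q|A B]; first by apply: continuousM; [apply: cF|apply: cG].
by have [[p pE] [q qE]] := (pF A B, pG A B); exists (p * q) => t; rewrite hornerM pE qE.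
Qed.

Lemma polyfunB F G : polyfun F -> polyfun G -> polyfun (fun Q => F Q - G Q).
Proof.
move=> pF pG; suff -> : (fun Q => F Q - G Q) = (fun Q => F Q + (- 1) * G Q).
  by apply: polyfunD => //; apply: polyfunM => //; apply: polyfun_cst.
by apply/funext => Q; rewrite mulN1r.
Qed.

Lemma polyfun_sum (I : Type) (r : seq I) (F : I -> 'M[R]_(m, n) -> R) :
  (forall i, polyfun (F i)) -> polyfun (fun Q => \sum_(i <- r) F i Q).
Proof.
move=> pF; elim: r => [|i r IH].
  by under eq_fun do rewrite big_nil; apply: polyfun_cst.
by under eq_fun do rewrite big_cons; apply: polyfunD.
Qed.

Lemma polyfun_prod (I : Type) (r : seq I) (F : I -> 'M[R]_(m, n) -> R) :
  (forall i, polyfun (F i)) -> polyfun (fun Q => \prod_(i <- r) F i Q).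
Proof.
move=> pF; elim: r => [|i r IH].
  by under eq_fun do rewrite big_nil; apply: polyfun_cst.
by under eq_fun do rewrite big_cons; apply: polyfunM.
Qed.

Lemma polyfun_det k (M : 'M[R]_(m, n) -> 'M[R]_k) :
  (forall i j, polyfun (fun Q => M Q i j)) -> polyfun (fun Q => \det (M Q)).
Proof.
move=> pM; apply: polyfun_sum => s; apply: polyfunM; first exact: polyfun_cst.
by apply: polyfun_prod.
Qed.

(** The numbers e/(k+2) for k below [size p] are too many to be all roots of [p]. *)
Lemma poly_small_nonroot (p : {poly R}) (e : R) : p != 0 -> 0 < e ->
  exists2 t, `|t| < e & p.[t] != 0.
Proof.
move=> p0 e0; pose s := [seq e / k.+2%:R | k <- iota 0 (size p)].
have [/allP rt|/allPn[t ts rt]] := boolP (all (root p) s); last first.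
  exists t; last by move: rt; rewrite rootE.
  move/mapP: ts => [k _ ->]; rewrite ger0_norm ?divr_ge0 ?ltW //.
  by rewrite ltr_pdivrMr // ltr_pMr // ltr1n.
have s_uniq : uniq s.
  rewrite map_inj_uniq ?iota_uniq // => k l /(mulfI (lt0r_neq0 e0))/invr_inj/eqP.
  by rewrite eqr_nat => /eqP[].
by have := max_poly_roots p0 (introT allP rt) s_uniq; rewrite size_map size_iota ltnn.
Qed.

Lemma polyfun_open_dense F : polyfun F -> (exists Q, F Q != 0) ->
  open [set Q | F Q != 0] /\ dense [set Q | F Q != 0].
Proof.
move=> [cF pF] [Q0 FQ0]; split.
  apply: (@open_comp _ _ F [set x | x != 0]); last exact: open_neq.
  by move=> Q _; apply: cF.
move=> U [Q UQ] openU.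
have [e /= e0 ballU] : nbhs_ball Q U by apply/nbhs_ballP; apply: open_nbhs_nbhs.
have [p pE] := pF Q (Q0 - Q).
have p0 : p != 0.
  apply: contraNneq FQ0 => p0; have := pE 1.
  by rewrite scale1r addrC subrK p0 horner0 => ->.
(* A strict, positive bound on all entries of [Q0 - Q]: a parameter below e/c in absolute value
   keeps the point of the line in the entrywise ball of radius e. *)
pose c := 1 + \sum_i \sum_j `|(Q0 - Q) i j|.
have c_ge i j : `|(Q0 - Q) i j| < c.
  rewrite /c ltr_pwDl // (bigD1 i) //= (bigD1 j) //=.
  by rewrite -addrA lerDl addr_ge0 ?sumr_ge0 // => k _; rewrite sumr_ge0.
have c0 : 0 < c by rewrite ltr_pwDl // sumr_ge0 // => i _; rewrite sumr_ge0.
have [t tlt pt] := poly_small_nonroot p0 (divr_gt0 e0 c0).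
exists (Q + t *: (Q0 - Q)); split; last by rewrite /= pE.
apply: ballU; split=> // i j; rewrite /ball /= !mxE opprD addNKr normrN normrM.
have [->|tn0] := eqVneq t 0; first by rewrite normr0 mul0r.
rewrite (lt_trans (_ : _ < `|t| * c)) //; last by rewrite -ltr_pdivlMr.
by rewrite ltr_pM2l ?normr_gt0 //; have := c_ge i j; rewrite !mxE.
Qed.

End PolynomialFunctions.

Lemma open_dense_bigcap (T : topologicalType) (I : finType) (U : I -> set T) :
  (forall i, open (U i) /\ dense (U i)) ->
  open [set x | forall i, U i x] /\ dense [set x | forall i, U i x].
Proof.
move=> oU; suff H (s : seq I) :
    open [set x | forall i, i \in s -> U i x] /\ dense [set x | forall i, i \in s -> U i x].
  have -> : [set x | forall i, U i x] = [set x | forall i, i \in enum I -> U i x].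
    by apply/seteqP; split=> x /= Ux i; [move=> _|apply: Ux; rewrite mem_enum].
  exact: H.
elim: s => [|i s [os ds]].
  have -> : [set x : T | forall i : I, i \in [::] -> U i x] = setT by apply/seteqP.
  by split; [exact: openT|move=> O [x Ox] _; exists x].
have -> : [set x | forall j, j \in i :: s -> U j x] =
    U i `&` [set x | forall j, j \in s -> U j x].
  apply/seteqP; split=> x /=.
    by move=> Ux; split=> [|j js]; apply: Ux; rewrite inE ?eqxx ?js ?orbT.
  by move=> [Ui Us] j; rewrite inE => /predU1P[->|/Us].
by have [oi di] := oU i; split; [exact: openI|exact: denseI].
Qed.

(** The set is a coset of the kernel of [A^T]: admissible directions lie in this kernel, and a basis
    of it attains the maximum. *)
Lemma affdim_coset (R : realType) (d r : nat) (A : 'M[R]_(r, d)) (X : set 'rV[R]_d) p0 :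
  X p0 -> (forall p, X p <-> (p - p0) *m A^T = 0) -> affdim X = (d - \rank A)%N.
Proof.
move=> Xp0 XE; have rk_ker : \rank (kermx A^T) = (d - \rank A)%N by rewrite mxrank_ker mxrank_tr.
apply/eqP; rewrite eqn_leq; apply/andP; split.
  apply/bigmax_leqP => k /asboolP[p [M [/XE pA Mfree XM]]].
  rewrite -rk_ker -(eqP Mfree); apply/mxrankS/sub_kermxP/row_matrixP => i.
  have /XE := XM i; rewrite row0 row_mul addrAC mulmxDl pA add0r.
  by [].
have ltd : (\rank (kermx A^T) < d.+1)%N by rewrite ltnS rank_leq_col.
rewrite -rk_ker; apply: (leq_bigmax_cond (Ordinal ltd)).
apply/asboolP; exists p0, (row_base (kermx A^T)); split=> // [|i].
  exact: row_base_free.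
apply/XE; rewrite [p0 + _]addrC addrK -row_mul.
have /sub_kermxP -> : (row_base (kermx A^T) <= kermx A^T)%MS by rewrite eq_row_base.
by rewrite row0.
Qed.

(** * Generic independence and inconsistency of the equations in [psi] *)

Section GenericPoints.
Variables (R : realType) (n d r : nat) (v w : 'I_r -> 'I_n).
Hypotheses (v_inj : injective v) (vw : forall i j, v i != w j).
Implicit Types (Q : 'M[R]_(n, d)) (P : 'rV[R]_d).

Definition sqn Q a : R := \sum_k Q a k ^+ 2.

Definition diff_mx Q : 'M[R]_(r, d) := \matrix_(i, k) (Q (v i) k - Q (w i) k).

(** The squares of the coordinates of [P] cancel, so [psi] is affine in [P] with normal proportional
    to the difference of the two points. *)
Lemma psiE Q a b P :
  psi Q a b P = - 2 * (\sum_k P 0 k * (Q a k - Q b k)) + (sqn Q a - sqn Q b).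
Proof.
rewrite /psi /sqdist /sqn mulr_sumr -!sumrB -big_split /=; apply: eq_bigr => k _.
by rewrite !mxE; ring.
Qed.

Lemma psi_diff_mx Q P i :
  psi Q (v i) (w i) P = - 2 * (P *m (diff_mx Q)^T) 0 i + (sqn Q (v i) - sqn Q (w i)).
Proof. by rewrite psiE mxE; congr (_ * _ + _); apply: eq_bigr => k _; rewrite !mxE. Qed.

Lemma polyfun_diff_mx i k : polyfun (fun Q => diff_mx Q i k).
Proof. by under eq_fun do rewrite mxE; apply: polyfunB; apply: polyfun_coord. Qed.

Lemma polyfun_sqn a : polyfun (fun Q => sqn Q a).
Proof. by apply: polyfun_sum => k; apply: polyfunM; apply: polyfun_coord. Qed.

(** Since no [v i] is a [w j], the points at [w] can sit at the origin while those at [v] are free;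
    this supplies the witnesses of non-vanishing. *)
Lemma place_points (N : 'M[R]_(r, d)) :
  exists Q, (forall i k, Q (v i) k = N i k) /\ (forall i k, Q (w i) k = 0).
Proof.
exists (\matrix_(a, k) \sum_(i | v i == a) N i k); split=> i k; rewrite mxE.
  by under eq_bigl do rewrite (inj_eq v_inj); rewrite big_pred1_eq.
by rewrite big_pred0 // => j; rewrite (negbTE (vw j i)).
Qed.

(** The minor on the first r columns is polynomial in [Q] and equals 1 when the differences are
    standard basis vectors. *)
Lemma generic_row_free : (r <= d)%N ->
  exists U : set 'M[R]_(n, d), (open U /\ dense U) /\ forall Q, U Q -> row_free (diff_mx Q).
Proof.
move=> rd; pose F (Q : 'M[R]_(n, d)) := \det (diff_mx Q *m (pid_mx r : 'M[R]_(d, r))).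
exists [set Q | F Q != 0]; split=> [|Q FQ].
  apply: polyfun_open_dense.
    apply: polyfun_det => i j; under eq_fun do rewrite mxE.
    apply: polyfun_sum => k; apply: polyfunM; first exact: polyfun_diff_mx.
    exact: polyfun_cst.
  have [Q [Qv Qw]] := place_points (pid_mx r); exists Q; rewrite /F.
  have -> : diff_mx Q = pid_mx r by apply/matrixP => i k; rewrite mxE Qv Qw subr0.
  by rewrite pid_mx_id // pid_mx_1 det1 oner_neq0.
have unitF : diff_mx Q *m (pid_mx r : 'M[R]_(d, r)) \in unitmx by rewrite unitmxE unitfE.
by apply/row_freeP; exists (pid_mx r *m invmx (diff_mx Q *m pid_mx r)); rewrite mulmxA mulmxV.
Qed.

Lemma psi_solution Q (g : 'I_r -> R) : row_free (diff_mx Q) ->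
  exists P, forall i, psi Q (v i) (w i) P = g i.
Proof.
move=> /row_freeP[B DB]; pose c := \col_i (g i - (sqn Q (v i) - sqn Q (w i))).
exists ((- 2)^-1 *: (B *m c)^T) => i; rewrite psi_diff_mx -scalemxAl -trmx_mul mulmxA DB mul1mx.
by rewrite 3!mxE mulrA divff ?mul1r ?subrK // oppr_eq0 pnatr_eq0.
Qed.

Lemma affdim_psi_solutions Q (g : 'I_r -> R) : row_free (diff_mx Q) ->
  affdim [set P | forall i, psi Q (v i) (w i) P = g i] = (d - r)%N.
Proof.
move=> Qfree; have [P0 gP0] := psi_solution g Qfree.
rewrite (@affdim_coset _ _ _ (diff_mx Q) _ P0) ?(eqP Qfree) // => P.
have two0 : - 2 != 0 :> R by rewrite oppr_eq0 pnatr_eq0.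
rewrite mulmxBl; split=> [gP|/eqP + i].
  apply/rowP => i; have := gP i; rewrite /= -(gP0 i) !psi_diff_mx => /addIr/(mulfI two0).
  by rewrite !mxE => ->; rewrite subrr.
by rewrite subr_eq0 -(gP0 i) !psi_diff_mx => /eqP ->.
Qed.

End GenericPoints.

(* The witness consists of the points [t e_k] and a last point [2 t e_0], which
   lie on no common sphere through the origin. *)
Lemma generic_no_solution (R : realType) (n d : nat) (v w : 'I_(d + 1) -> 'I_n)
    (g : 'I_(d + 1) -> R) :
  (0 < d)%N -> injective v -> (forall i j, v i != w j) ->
  exists U : set 'M[R]_(n, d), (open U /\ dense U) /\
    forall Q, U Q -> ~ exists P, forall i, psi Q (v i) (w i) P = g i.
Proof.
move=> d0 v_inj vw.
(* [N Q] is the augmented matrix of the system; a solution P would put the nonzero vector (-2P, 1)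
   in its kernel. *)
pose c (Q : 'M[R]_(n, d)) : 'cV[R]_(d + 1) := \col_i (sqn Q (v i) - sqn Q (w i) - g i).
pose N (Q : 'M[R]_(n, d)) := row_mx (diff_mx v w Q) (c Q).
exists [set Q | \det (N Q) != 0]; split=> [|Q detN [P gP]]; last first.
  have unitN : N Q \in unitmx by rewrite unitmxE unitfE.
  have : N Q *m col_mx (- 2 *: P^T) 1%:M = 0.
    rewrite mul_row_col mulmx1 -scalemxAr; apply/colP => i.
    have PE : (P *m (diff_mx v w Q)^T) 0 i = (diff_mx v w Q *m P^T) i 0.
      by rewrite -[in RHS](trmxK (_ *m _)) trmx_mul trmxK [RHS]mxE.
    rewrite [LHS]mxE [X in X + _]mxE [c Q i 0]mxE [RHS]mxE -(gP i) psi_diff_mx PE.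
    by ring.
  move/(congr1 (mulmx (invmx (N Q)))); rewrite mulKmx // mulmx0 -col_mx0 => /eq_col_mx[_].
  by move/matrixP/(_ 0 0)/eqP; rewrite !mxE oner_eq0.
apply: polyfun_open_dense.
  apply: polyfun_det => i j; rewrite /N; case: (split_ordP j) => k ->.
    by under eq_fun do rewrite row_mxEl; apply: polyfun_diff_mx.
  under eq_fun do rewrite row_mxEr mxE.
  by apply: polyfunB; [apply: polyfunB; apply: polyfun_sqn|apply: polyfun_cst].
pose k0 := Ordinal d0.
(* Subtracting twice row [k0] from the last row of the system leaves (2t^2 + h) s = 0. If t = 1
   makes this factor vanish, t = 2 gives it the value 6. *)
pose h := 2 * g (lshift 1 k0) - g (rshift d 0).
have [t [t0 th]] : exists t : R, t != 0 /\ 2 * t ^+ 2 + h != 0.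
  have [h2|h2] := eqVneq (2 + h) 0; last by exists 1; rewrite oner_neq0 expr1n mulr1.
  exists 2; rewrite pnatr_eq0; split=> //.
  have -> : 2 * 2 ^+ 2 + h = 6 + (2 + h) by ring.
  by rewrite h2 addr0 pnatr_eq0.
pose M : 'M[R]_(d + 1, d) := col_mx t%:M (\row_k ((2 * t) *+ (k == k0))).
have [Q [Qv Qw]] := place_points v_inj vw M; exists Q.
have sqn_w i : sqn Q (w i) = 0 by rewrite /sqn big1 // => k _; rewrite Qw expr0n.
have sqn_l (k : 'I_d) : sqn Q (v (lshift 1 k)) = t ^+ 2.
  rewrite /sqn (bigD1 k) //= Qv col_mxEu mxE eqxx mulr1n big1 ?addr0 // => l lk.
  by rewrite Qv col_mxEu mxE eq_sym (negbTE lk) expr0n.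
have sqn_r : sqn Q (v (rshift d 0)) = 4 * t ^+ 2.
  rewrite /sqn (bigD1 k0) //= Qv col_mxEd mxE eqxx mulr1n big1 ?addr0 => [|l lk].
    by ring.
  by rewrite Qv col_mxEd mxE (negbTE lk) expr0n.
suff : (N Q)^T \in unitmx by rewrite unitmx_tr unitmxE unitfE.
rewrite -row_free_unit; apply/inj_row_free => u /(congr1 trmx).
rewrite trmx_mul trmxK trmx0 -[u]hsubmxK tr_row_mx mul_row_col.
move: (lsubmx u) (rsubmx u) => {u} y s Nu.
have NuE i : (\sum_k M i k * y 0 k) + c Q i 0 * s 0 0 = 0.
  have /matrixP/(_ i 0) := Nu; rewrite !mxE big_ord1 !mxE => Nui.
  rewrite -[RHS]Nui; congr (_ + _); apply: eq_bigr => k _.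
  by rewrite -Qv [diff_mx _ _ _ _ _]mxE [y^T _ _]mxE Qw subr0.
have NuL k : t * y 0 k + (t ^+ 2 - g (lshift 1 k)) * s 0 0 = 0.
  rewrite -[RHS](NuE (lshift 1 k)) mxE sqn_l sqn_w subr0; congr (_ + _).
  rewrite (bigD1 k) //= col_mxEu mxE eqxx mulr1n big1 ?addr0 // => l lk.
  by rewrite col_mxEu mxE eq_sym (negbTE lk) mul0r.
have NuR : 2 * t * y 0 k0 + (4 * t ^+ 2 - g (rshift d 0)) * s 0 0 = 0.
  rewrite -[RHS](NuE (rshift d 0)) mxE sqn_r sqn_w subr0; congr (_ + _).
  rewrite (bigD1 k0) //= col_mxEd mxE eqxx mulr1n big1 ?addr0 // => l lk.
  by rewrite col_mxEd mxE (negbTE lk) mul0r.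
have s0 : s 0 0 = 0.
  have : (2 * t ^+ 2 + h) * s 0 0 = 0.
    rewrite -[RHS]NuR -[RHS]subr0 -[X in _ = _ - X](mulr0 2) -[X in _ = _ - 2 * X](NuL k0) /h.
    by ring.
  by move/eqP; rewrite mulf_eq0 (negbTE th) => /eqP.
have y0 k : y 0 k = 0.
  by have /eqP := NuL k; rewrite s0 mulr0 addr0 mulf_eq0 (negbTE t0) => /eqP.
have -> : y = 0 by apply/rowP => k; rewrite y0 mxE.
have -> : s = 0 by apply/rowP => k; rewrite ord1 s0 mxE.
exact: row_mx0.
Qed.

(** * The arrangement *)

Section Arrangement.
Variables (R : realType) (n : nat) (E : finType).
Variables (ends : E -> 'I_n * 'I_n) (phi : E -> R) (d : nat).
Hypothesis ends_neq : forall e, (ends e).1 != (ends e).2.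
Implicit Types (S T : {set E}) (f : 'I_n -> R) (Q : 'M[R]_(n, d)) (P : 'rV[R]_d).

Notation rep S := (fingraph.root (adj ends S)).
Notation corank S := (n - ncomp ends S)%N.

Lemma inter_potential Q S P :
  inter ends phi Q S P -> potential ends phi S (fun u => sqdist P (row u Q)).
Proof. by move=> SP e /SP <-. Qed.

Lemma inter_connect Q S f P u v : potential ends phi S f -> inter ends phi Q S P ->
  connect (adj ends S) u v -> psi Q u v P = f u - f v.
Proof.
move=> fS SP uv; pose h u := sqdist P (row u Q) - f u.
have huv : h u = h v.
  apply: connect_adj_const uv => e eS; rewrite /h.
  by have := fS e eS; rewrite (inter_potential SP eS) /=; lra.
by move: huv; rewrite /psi /h; lra.
Qed.

(** Equations along edges are traded for one equation per non-root vertex, relative to its root; the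
    two ends of an edge share a root, so subtracting their equations recovers that of the edge. *)
Lemma interE Q S f P : potential ends phi S f ->
  inter ends phi Q S P <->
  forall i : 'I_#|[pred u | rep S u != u]|,
    psi Q (enum_val i) (rep S (enum_val i)) P =
    f (enum_val i) - f (rep S (enum_val i)).
Proof.
move=> fS; split=> [SP i|gP]; first exact: inter_connect (rep_connect _ _ _).
have {}gP u : psi Q u (rep S u) P = f u - f (rep S u).
  have [uS|uS] := eqVneq (rep S u) u; first by rewrite uS /psi !subrr.
  have uA : u \in [pred u | rep S u != u] by rewrite inE.
  by have := gP (enum_rank_in uA u); rewrite enum_rankK_in.
move=> e eS; rewrite /hyp /= (fS e eS).
have /eqP repE : rep S (ends e).1 == rep S (ends e).2.
  by rewrite rep_eq; apply/connect1/adj_ends.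
have := gP (ends e).1; have := gP (ends e).2; rewrite -repE /psi; lra.
Qed.

(** For unbalanced [S] the intersection is empty for every [Q]. For balanced [S] the size of the
    system in [interE] decides between [generic_row_free] and [generic_no_solution]. *)
Lemma generic_inter S : (0 < d)%N ->
  exists U : set 'M[R]_(n, d), (open U /\ dense U) /\
  forall Q, U Q ->
    (balanced ends phi S -> (corank S <= d)%N -> inter ends phi Q S !=set0) /\
    (inter ends phi Q S !=set0 ->
      (corank S <= d)%N /\ affdim (inter ends phi Q S) = (d - corank S)%N).
Proof.
move=> d0; have [balS|unbalS] := pselect (balanced ends phi S); last first.
  exists setT; split=> [|Q _]; first by split; [exact: openT|move=> O [x Ox] _; exists x].
  split=> // -[P /inter_potential/potential_balanced balS]; by case: unbalS.
have [f fS] := balanced_potential ends_neq balS.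
rewrite corankE; set A := [pred u | rep S u != u].
pose v (i : 'I_#|A|) : 'I_n := enum_val i; pose w i := rep S (v i).
have v_inj : injective v by exact: enum_val_inj.
have vw i j : v i != w j.
  apply/eqP => vij; have := enum_valP i; rewrite inE -/(v i) vij /w.
  by rewrite rep_eq connect_adj_sym rep_connect.
have [Ad|dA] := leqP #|A| d.
  have [U [oU freeU]] := @generic_row_free R n d _ v w v_inj vw Ad.
  exists U; split=> // Q /freeU Qfree.
  have -> : inter ends phi Q S = [set P | forall i, psi Q (v i) (w i) P = f (v i) - f (w i)].
    by apply/seteqP; split=> P /(interE Q P fS).
  split=> [_ _|_]; last by rewrite affdim_psi_solutions.
  exact: psi_solution Qfree.
have dA' : (d + 1 <= #|A|)%N by rewrite addn1.
(* The first d + 1 equations are already generically inconsistent. *)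
pose z := widen_ord dA'.
have z_inj : injective z by move=> i j /(congr1 val) /= ij; apply: val_inj.
have [U [oU noU]] := @generic_no_solution R n d (v \o z) (w \o z)
  (fun i => f (v (z i)) - f (w (z i))) d0 (inj_comp v_inj z_inj) (fun i j => vw _ _).
exists U; split=> // Q /noU noQ; split=> // -[P /(interE Q P fS) gP].
by case: noQ; exists P => i; apply: gP.
Qed.

(** One half of the Galois connection between edge sets and subsets of space; [inter] is the
    other. *)
Definition flat_above Q (X : set 'rV[R]_d) : {set E} :=
  [set e | `[< X `<=` hyp ends phi Q e >]]%SET.

Lemma inter_flat_above Q S : inter ends phi Q (flat_above Q (inter ends phi Q S)) = inter ends phi Q S.
Proof.
apply/seteqP; split=> P SP e; last by rewrite inE => /asboolP; apply.
by move=> eS; apply: SP; rewrite inE; apply/asboolP => P'; apply.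
Qed.

(** Squared distance to a common point is a potential, whence balance. If [e] joins connected
    vertices and keeps balance, a potential on the enlarged set forces the equation of [e] on the
    whole intersection, so [e] was already there. *)
Lemma flat_above_balanced Q S : inter ends phi Q S !=set0 ->
  balanced_flat ends phi (flat_above Q (inter ends phi Q S)).
Proof.
rewrite -{1}inter_flat_above => -[P BP]; split.
  exact: potential_balanced (inter_potential BP).
move=> e + econn balB; case/negP; rewrite inE; apply/asboolP => P'.
have [f fB] := balanced_potential ends_neq balB.
have fB' : potential ends phi (flat_above Q (inter ends phi Q S)) f.
  by move=> e' e'B; apply: fB; rewrite inE e'B orbT.
rewrite -{1}inter_flat_above => BP'.
by rewrite /hyp /= (inter_connect fB' BP' econn) (fB e) ?finset.setU11.
Qed.

Lemma flat_aboveS Q S T :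
  (flat_above Q (inter ends phi Q S) \subset flat_above Q (inter ends phi Q T)) =
  `[< inter ends phi Q T `<=` inter ends phi Q S >].
Proof.
apply/idP/asboolP => [/fintype.subsetP ST P TP|TS].
  by rewrite -inter_flat_above => e /ST; rewrite inE => /asboolP; apply.
apply/fintype.subsetP => e; rewrite inE => /asboolP eS.
by rewrite inE; apply/asboolP => P /TS/eS.
Qed.

Lemma LHP Q (x : LH ends phi Q) :
  exists S, val x = inter ends phi Q S /\ inter ends phi Q S !=set0.
Proof.
by have /imfsetP[S /= /asboolP S0 xS] := valP x; exists S.
Qed.

Lemma in_LH Q S : inter ends phi Q S !=set0 -> inter ends phi Q S \in LH ends phi Q.
Proof. by move=> S0; apply/imfsetP; exists S => //=; apply/asboolP. Qed.

Lemma flat_of_proof Q (x : LH ends phi Q) : `[< balanced_flat ends phi (flat_above Q (val x)) >].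
Proof. by apply/asboolP; have [S [-> S0]] := LHP x; apply: flat_above_balanced. Qed.

Definition flat_of Q (x : LH ends phi Q) : latb ends phi := 
  exist (fun S => is_true `[< balanced_flat ends phi S >]) _ (flat_of_proof x).

Lemma flat_of_le Q (x y : LH ends phi Q) : latb_le (flat_of x) (flat_of y) = LH_le x y.
Proof.
rewrite /latb_le /LH_le /=; have [S [-> _]] := LHP x; have [T [-> _]] := LHP y.
exact: flat_aboveS.
Qed.

Lemma flat_of_inj Q : injective (@flat_of Q).
Proof.
move=> x y xy; apply/val_inj/seteqP.
by split; apply/asboolP; rewrite -[asbool _]flat_of_le xy latb_le_refl.
Qed.

(* In dimension 0 every hyperplane is empty or the whole space, whatever the
   gain, so [flat_of] has the wrong rank and this case is treated apart. *)
Lemma latb_set0_proof : `[< balanced_flat ends phi finset.set0 >].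
Proof.
apply/asboolP; split; first by apply: (@potential_balanced _ _ _ _ _ _ (fun=> 0)) => e; rewrite inE.
move=> e _ econn _; have := ends_neq e.
by rewrite (connect_adj_const (h := id) _ econn) ?eqxx // => e'; rewrite inE.
Qed.

Definition latb_set0 : latb ends phi := 
  exist (fun S => is_true `[< balanced_flat ends phi S >]) _ latb_set0_proof.

Lemma latb_rk_set0 : latb_rk latb_set0 = 0%N.
Proof.
rewrite /latb_rk /= corankE; apply: eq_card0 => u; rewrite !inE.
apply/negbTE; rewrite negbK eq_sym; apply/eqP.
by apply: (connect_adj_const (h := id) _ (rep_connect ends finset.set0 u)) => e; rewrite inE.
Qed.

(** Space is a single point, hence the only nonempty intersection; the only flat of rank 0 is the
    empty one, by [latb_eq]. *)
Lemma LH_dim0 (Q : 'M[R]_(n, d)) : d = 0%N ->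
  [/\ injective (fun _ : LH ends phi Q => latb_set0),
      forall x y : LH ends phi Q, latb_le latb_set0 latb_set0 = LH_le x y,
      forall x : LH ends phi Q, latb_rk latb_set0 = LH_rk x &
      forall B, (B \in codom (fun _ : LH ends phi Q => latb_set0)) = (latb_rk B <= d)%N].
Proof.
move=> d0.
have rV0 (P P' : 'rV[R]_d) : P = P'.
  by apply/rowP => k; have := ltn_ord k; rewrite {2}d0.
have LHT (x : LH ends phi Q) : val x = setT.
  have [S [-> [P SP]]] := LHP x; apply/seteqP; split=> // P' _.
  by rewrite (rV0 P' P).
have set0_le B : latb_le latb_set0 B by apply: finset.sub0set.
split=> [x y _|x y|x|B].
- by apply: val_inj; rewrite !LHT.
- by rewrite set0_le; apply/esym/asboolP; rewrite !LHT.
- by apply/esym/eqP; rewrite latb_rk_set0 subn_eq0 [X in (X <= _)%N]d0.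
- rewrite [X in (_ <= X)%N]d0 leqn0; apply/codomP/eqP => [[_ ->]|B0]; first exact: latb_rk_set0.
  have T0 : inter ends phi Q finset.set0 !=set0 by exists 0 => e; rewrite inE.
  by exists [` in_LH T0]%fset; apply/esym/latb_eq; rewrite ?latb_rk_set0.
Qed.

(** The flat above an intersection X cuts out X itself, so the dimension formula applies to that
    flat. A flat [B] of rank at most d lies in the flat above its own intersection, which has the
    same rank, so the two agree. *)
Lemma flat_of_generic Q :
  (forall S : {set E},
    (balanced ends phi S -> (corank S <= d)%N -> inter ends phi Q S !=set0) /\
    (inter ends phi Q S !=set0 ->
      (corank S <= d)%N /\ affdim (inter ends phi Q S) = (d - corank S)%N)) ->
  (forall x, latb_rk (@flat_of Q x) = LH_rk x) /\
  (forall B, (B \in codom (@flat_of Q)) = (latb_rk B <= d)%N).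
Proof.
move=> genQ.
have rkE x : latb_rk (@flat_of Q x) = LH_rk x /\ (latb_rk (flat_of x) <= d)%N.
  rewrite /LH_rk /latb_rk /=; have [S [-> S0]] := LHP x.
  have [_] := genQ (flat_above Q (inter ends phi Q S)).
  by rewrite inter_flat_above => /(_ S0) [rkd ->]; rewrite subKn.
split=> [x|B]; first by case: (rkE x).
apply/codomP/idP => [[x ->]|Bd]; first by case: (rkE x).
have [balB flatB] := latbP B.
have B0 : inter ends phi Q (val B) !=set0 by case: (genQ (val B)) => + _; apply.
exists [` in_LH B0]%fset; apply: latb_eq => //.
  by apply/fintype.subsetP => e eB; rewrite inE; apply/asboolP => P; apply.
have [-> _] := rkE [` in_LH B0]%fset; have [_ /(_ B0)[_ affB]] := genQ (val B).
by rewrite /LH_rk /= affB subKn.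
Qed.

End Arrangement.

Theorem theorem10p3 (R : realType) (n : nat) (E : finType)
    (ends : E -> 'I_n * 'I_n) (phi : E -> R) (d : nat) :
  (forall e, (ends e).1 != (ends e).2) ->
  (d <= n)%N ->
  exists U : set 'M[R]_(n, d),
    [/\ open U, dense U &
      forall Q, U Q ->
        pH ends phi Q = poly_part_div (n - d) (chib ends phi) /\
        wH ends phi Q = poly_part_div (n - d) (wb ends phi)].
Proof.
move=> ends_neq dn.
have embedding (Q : 'M[R]_(n, d)) (F : LH ends phi Q -> latb ends phi) : injective F ->
    (forall x y, latb_le (F x) (F y) = LH_le x y) -> (forall x, latb_rk (F x) = LH_rk x) ->
    (forall B, (B \in codom F) = (latb_rk B <= d)%N) ->
    pH ends phi Q = poly_part_div (n - d) (chib ends phi) /\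
    wH ends phi Q = poly_part_div (n - d) (wb ends phi).
  move=> F_inj F_le F_rk F_codom.
  have lexx := @latb_le_refl R n E ends phi.
  have le_anti := @latb_le_anti R n E ends phi.
  have le_trans := @latb_le_trans R n E ends phi.
  have rk_le := @latb_rk_le R n E ends phi.
  split.
    exact: (char_poly_ideal R lexx le_anti le_trans F_inj F_le F_rk rk_le F_codom dn).
  exact: (whitney_poly_ideal R lexx le_anti le_trans F_inj F_le F_rk rk_le F_codom dn).
have [d0|d0] := posnP d.
  exists setT; split=> [||Q _]; [exact: openT|by move=> O [x Ox] _; exists x|].
  by have [] := LH_dim0 phi ends_neq Q d0; apply: embedding.
(* One generic set is chosen per edge set; there are finitely many, so their intersection is still
   open and dense. *)
have [U] := choice (fun S => @generic_inter R n E ends phi d ends_neq S d0).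
move=> /all_and2[/open_dense_bigcap[openU denseU] UP].
exists [set Q | forall S, U S Q]; split=> // Q UQ.
have [rkE codomE] := flat_of_generic ends_neq (fun S => UP S Q (UQ S)).
exact: (embedding _ _ (@flat_of_inj _ _ _ _ _ _ ends_neq Q) (@flat_of_le _ _ _ _ _ _ ends_neq Q)).
Qed.
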